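(* Suppose $A$, $B$, $C$ and $D$ are disks in Descartes configuration, where $D$ is the fourth inscribed disk (a solution of the Descartes problem for $A,B,C$), and let $D'$ be the second solution of the Descartes problem for $A,B,C$. Let $\mathbf a,\mathbf b,\mathbf c\in\mathbb R^2$ be the tangency spinors joining $A,B,C$, oriented clockwise: $\mathbf a$ from $B$ to $C$, $\mathbf b$ from $C$ to $A$, $\mathbf c$ from $A$ to $B$, with signs chosen so that $\mathbf a+\mathbf b+\mathbf c=\mathbf 0$. Then the three-spinor tessellation built on these spinors determines curvatures of disks and circles as follows (the letters $A,B,C$ also denote the curvatures of the disks, $\mathrm{Curv}$ is curvature and $\mathrm{Area}$ is area, which may be negative for some tiles). (1) The curvatures $A$, $B$, $C$ are equal to the areas of the three red tiles: $A=\mathrm{Area}(R_A)$, $B=\mathrm{Area}(R_B)$, $C=\mathrm{Area}(R_C)$. The fourth inscribed disk has curvature equal to the area of a butterfly (any of the three): $$\mathrm{Curv}(D)=\mathrm{Area}(\text{3 red}+\text{two green})=\mathrm{Area}(\text{yellow}+\text{aligned red}+\text{two green}).$$ Equivalently, one may consider the ring of three red tiles (one of them light red) and two green tiles. (2) All green tiles have the same area, equal to the curvature of the mid-circle $(ABC)$ that passes through the points of tangency of the disks $A,B,C$. This and the other mid-circles have curvatures $$\mathrm{Curv}(ABC)=\mathrm{Area}(\text{any green}),$$ $$\mathrm{Curv}(ABD)=\mathrm{Area}(\text{yellow}(A+B)+\text{green}),$$ $$\mathrm{Curv}(BCD)=\mathrm{Area}(\text{yellow}(B+C)+\text{green}),$$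 $$\mathrm{Curv}(CAD)=\mathrm{Area}(\text{yellow}(C+A)+\text{green}).$$ (3) The second solution $D'$ of the Descartes problem for $A,B,C$ is the disk of curvature $$\mathrm{Curv}(D')=\mathrm{Area}(\text{3 red}-\text{two green})=\mathrm{Area}(\text{yellow}+\text{aligned red}-\text{two green}).$$ The mid-circles for this Descartes configuration are $$\mathrm{Curv}(ABD')=\mathrm{Area}(\text{yellow}(A+B)-\text{green}),$$ $$\mathrm{Curv}(BCD')=\mathrm{Area}(\text{yellow}(B+C)-\text{green}),$$ $$\mathrm{Curv}(CAD')=\mathrm{Area}(\text{yellow}(C+A)-\text{green}).$$ Here a sum or difference of tiles inside $\mathrm{Area}$ means the corresponding sum or difference of their areas, and yellow$(A+B)$, yellow$(B+C)$, yellow$(C+A)$ are the yellow squares $Y_{\mathbf c}$, $Y_{\mathbf a}$, $Y_{\mathbf b}$, whose areas are $A+B$, $B+C$, $C+A$.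
   Context: Disks and Descartes configurations. The curvature of a disk is the reciprocal of its radius. Unbounded disks, extending outside a circle, are allowed and are given negative radius and negative curvature (a half-plane, as a limiting case, has curvature $0$). A Descartes configuration is an arrangement of four mutually tangent disks. The Descartes problem: given three mutually tangent disks $A,B,C$, find a fourth disk tangent to all three; there are two solutions, $D$ and $D'$. Mid-circles. For three mutually tangent disks $X,Y,Z$, the mid-circle $(XYZ)$ is the unique circle through their three points of tangency. Its curvature is in absolute value the reciprocal of its radius; the formulas may yield a negative value (or $0$, for a line). Arrangement. ''Clockwise'' means that the points of tangency of $BC$, $CA$, $AB$ follow each other in clockwise order on the mid-circle $(ABC)$; the inscribed disk $D$ is the solution lying inside the mid-circle $(ABC)$, and $D'$ is the other one. (If $(ABC)$ is a line, $D$ and $D'$ have equal curvatures and the choice is immaterial.) Tangency spinor. For an ordered pair $(X,Y)$ of tangent disks of radii $r_X,r_Y$ and centers $c_X,c_Y$ in the plane $\mathbb C\cong\mathbb R^2$, the tangency spinor is $u=\pm\sqrt{(c_Y-c_X)/(r_Xr_Y)}\in\mathbb C$, defined up to sign and viewed as the vector $\mathbf u=(\mathrm{Re}\,u,\mathrm{Im}\,u)\in\mathbb R^2$. It is said to go from $X$ to $Y$. For three mutually tangent disks the signs of the three spinors can be chosen so that $\mathbf a+\mathbf b+\mathbf c=\mathbf 0$. Three-spinor tessellation. For $\mathbf v=(x,y)$ put $\mathbf v^\star=(-y,x)$, and for $\mathbf v=(x,y)$, $\mathbf w=(x',y')$ put $\mathbf v\times\mathbf w=xy'-x'y$. Let $P(\mathbf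 p;\mathbf v,\mathbf w)$ be the parallelogram with vertices $\mathbf p,\ \mathbf p+\mathbf v,\ \mathbf p+\mathbf v+\mathbf w,\ \mathbf p+\mathbf w$; its area is taken as the signed quantity $\mathbf v\times\mathbf w$. Any vectors with $\mathbf a+\mathbf b+\mathbf c=\mathbf 0$ are admissible; for some choices certain tiles have negative area and overlap other tiles. The tessellation consists of 15 tiles: - yellow squares: $Y_{\mathbf a}=P(\mathbf 0;\mathbf a,\mathbf a^\star)$, $Y_{\mathbf b}=P(\mathbf 0;\mathbf b,\mathbf b^\star)$, $Y_{\mathbf c}=P(\mathbf 0;\mathbf c,\mathbf c^\star)$; - red tiles: $R_A=P(\mathbf 0;\mathbf b^\star,\mathbf c)$, $R_B=P(\mathbf 0;\mathbf c^\star,\mathbf a)$, $R_C=P(\mathbf 0;\mathbf a^\star,\mathbf b)$; - green tiles: $P(\mathbf a^\star;\mathbf a,\mathbf b)$ and $P(\mathbf a;\mathbf c^\star,\mathbf a^\star)$ (adjacent to $Y_{\mathbf a}$); $P(\mathbf b^\star;\mathbf b,\mathbf c)$ and $P(\mathbf b;\mathbf a^\star,\mathbf b^\star)$ (adjacent to $Y_{\mathbf b}$); $P(\mathbf c^\star;\mathbf c,\mathbf a)$ and $P(\mathbf c;\mathbf b^\star,\mathbf c^\star)$ (adjacent to $Y_{\mathbf c}$); - light-red tiles: $P(\mathbf a+\mathbf a^\star;\mathbf c^\star,\mathbf b)$, $P(\mathbf b+\mathbf b^\star;\mathbf a^\star,\mathbf c)$, $P(\mathbf c+\mathbf c^\star;\mathbf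 b^\star,\mathbf a)$. The red tile aligned with a yellow square is the one touching it only at the vertex $\mathbf 0$: $R_A$ for $Y_{\mathbf a}$, $R_B$ for $Y_{\mathbf b}$, $R_C$ for $Y_{\mathbf c}$. A butterfly consists of a yellow square, the two green tiles adjacent to it, and the light-red tile at its vertex opposite to $\mathbf 0$. A ring consists of the tiles surrounding a yellow square: the two red tiles sharing an edge with it, the two green tiles adjacent to it, and the light-red tile at its vertex opposite to $\mathbf 0$. *)

(* Defs.v *)
From Stdlib Require Import Reals List.
From Coquelicot Require Import Coquelicot.
Import ListNotations.
Open Scope R_scope.

(* The plane is Coquelicot's C = R * R.  Points of the extended plane are
   elements of [option C], [None] being the point at infinity. *)

Definition dot (v w : C) : R := Re v * Re w + Im v * Im w.
Definition cross (v w : C) : R := Re v * Im w - Re w * Im v.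
Definition star (v : C) : C := (- Im v, Re v).

(** * Circles and disks *)

(* [Line n h] is the line { z | dot n z = h }, n a unit vector. *)
Inductive gcircle : Type :=
| Circle (o : C) (rho : R)
| Line (n : C) (h : R).

Definition is_circle (M : gcircle) : Prop :=
  match M with
  | Circle _ rho => 0 < rho
  | Line n _ => Cmod n = 1
  end.

Definition on_circle (M : gcircle) (p : option C) : Prop :=
  match M, p with
  | Circle o rho, Some z => Cmod (z - o)%C = rho
  | Circle _ _, None => False
  | Line n h, Some z => dot n z = h
  | Line _ _, None => True
  end.

Definition circle_curv (M : gcircle) : R :=
  match M with
  | Circle _ rho => / rho
  | Line _ _ => 0
  end.

(* [Ball c r] with r < 0 is the unbounded disk outside the circle of center c
   and radius -r.  [HalfPlane n h] is { z | dot n z <= h }, so that the unit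
   vector n is its outward normal. *)
Inductive disk : Type :=
| Ball (c : C) (r : R)
| HalfPlane (n : C) (h : R).

Definition is_disk (X : disk) : Prop :=
  match X with
  | Ball _ r => r <> 0
  | HalfPlane n _ => Cmod n = 1
  end.

Definition curv (X : disk) : R :=
  match X with
  | Ball _ r => / r
  | HalfPlane _ _ => 0
  end.

Definition boundary (X : disk) : gcircle :=
  match X with
  | Ball c r => Circle c (Rabs r)
  | HalfPlane n h => Line n h
  end.

Definition in_interior (X : disk) (z : C) : Prop :=
  match X with
  | Ball c r =>
      (0 < r /\ Cmod (z - c)%C < r) \/ (r < 0 /\ - r < Cmod (z - c)%C)
  | HalfPlane n h => dot n z < h
  end.

Definition in_disk (X : disk) (z : C) : Prop :=
  in_interior X z \/ on_circle (boundary X) (Some z).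

(** * Tangency and Descartes configurations *)

Definition tangency_point (X Y : disk) (p : option C) : Prop :=
  on_circle (boundary X) p /\ on_circle (boundary Y) p.

(* Two disjoint half-planes with parallel boundaries are tangent at infinity. *)
Definition tangent (X Y : disk) : Prop :=
  (forall z : C, ~ (in_interior X z /\ in_interior Y z)) /\
  (exists! p : option C, tangency_point X Y p).

Definition descartes_configuration (X Y Z W : disk) : Prop :=
  (is_disk X /\ is_disk Y /\ is_disk Z /\ is_disk W) /\
  tangent X Y /\ tangent Y Z /\ tangent Z X /\
  tangent X W /\ tangent Y W /\ tangent Z W.

(** * Mid-circles *)

Definition is_midcircle (M : gcircle) (X Y Z : disk) : Prop :=
  is_circle M /\
  exists p q s : option C,
    tangency_point Y Z p /\ tangency_point Z X q /\ tangency_point X Y s /\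
    on_circle M p /\ on_circle M q /\ on_circle M s.

(* The curvature of a mid-circle is only specified up to sign.  A line has two
   representations [Line n h] and [Line (-n) (-h)], whence the absence of
   [exists!] here. *)
Definition midcircle_curvature (X Y Z : disk) (k : R) : Prop :=
  (exists M : gcircle, is_midcircle M X Y Z) /\
  (forall M : gcircle, is_midcircle M X Y Z -> Rabs k = circle_curv M).

Definition point_at (o : C) (rho theta : R) : C :=
  (o + ((rho * cos theta)%R, (rho * sin theta)%R))%C.

(* Vacuous when the mid-circle is a line, and likewise for [inscribed]: the
   second solution then has the same curvature as the first. *)
Definition clockwise (X Y Z : disk) : Prop :=
  forall (o : C) (rho : R), is_midcircle (Circle o rho) X Y Z ->
  exists alpha beta gamma : R,
    alpha > beta /\ beta > gamma /\ gamma > alpha - 2 * PI /\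
    tangency_point Y Z (Some (point_at o rho alpha)) /\
    tangency_point Z X (Some (point_at o rho beta)) /\
    tangency_point X Y (Some (point_at o rho gamma)).

Definition inscribed (W X Y Z : disk) : Prop :=
  forall (o : C) (rho : R), is_midcircle (Circle o rho) X Y Z ->
  forall z : C, in_disk W z -> Cmod (z - o)%C <= rho.

(** * Tangency spinors *)

(* (c_Y - c_X) / (r_X r_Y), extended to half-planes by its limit as the radius
   tends to infinity.  Indeed, for tangent disks it is equal to
   (1/r_X + 1/r_Y) e, where e is the unit vector that is normal to both
   boundaries at the point of tangency and points from X to Y. *)
Definition spinor_square (X Y : disk) : C :=
  match X, Y with
  | Ball cX rX, Ball cY rY => ((cY - cX) / RtoC (rX * rY))%C
  | HalfPlane n _, Ball _ rY => (n / RtoC rY)%C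
  | Ball _ rX, HalfPlane n _ => (- n / RtoC rX)%C
  | HalfPlane _ _, HalfPlane _ _ => 0%C
  end.

Definition tangency_spinor (u : C) (X Y : disk) : Prop :=
  (u * u)%C = spinor_square X Y.

(** * The three-spinor tessellation *)

(* The parallelogram with vertices p, p + v, p + v + w, p + w. *)
Record tile : Type := P { corner : C; side1 : C; side2 : C }.

Definition Area (t : tile) : R := cross (side1 t) (side2 t).

Definition total_area (l : list tile) : R :=
  fold_right (fun t s => Area t + s) 0 l.

(* In the functions of v, w, x below, (v, w, x) is meant to be one of
   (a, b, c), (b, c, a), (c, a, b). *)
Definition yellow (v : C) : tile := P 0 v (star v).
Definition aligned_red (v w x : C) : tile := P 0 (star w) x.
Definition green1 (v w x : C) : tile := P (star v) v w.
Definition green2 (v w x : C) : tile := P v (star x) (star v).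
Definition light_red (v w x : C) : tile := P (v + star v)%C (star x) w.

Definition red_A (a b c : C) : tile := aligned_red a b c.
Definition red_B (a b c : C) : tile := aligned_red b c a.
Definition red_C (a b c : C) : tile := aligned_red c a b.

Definition reds (a b c : C) : list tile :=
  [red_A a b c; red_B a b c; red_C a b c].

Definition greens (a b c : C) : list tile :=
  [green1 a b c; green2 a b c;
   green1 b c a; green2 b c a;
   green1 c a b; green2 c a b].

Definition butterfly (v w x : C) : list tile :=
  [yellow v; green1 v w x; green2 v w x; light_red v w x].

(* The red tiles sharing an edge with [yellow v] are those aligned with
   [yellow w] and [yellow x]. *)
Definition ring (v w x : C) : list tile :=
  [aligned_red w x v; aligned_red x v w; green1 v w x; green2 v w x;
   light_red v w x].

(* Main.v *)
Require Import Defs.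
From Stdlib Require Import Reals List Lra Nsatz.
From Coquelicot Require Import Coquelicot.
Import ListNotations.
Open Scope R_scope.

(** Write the disk of curvature k and center z as the vector (k, k z, l), with
    l chosen so that the vector has norm 1 for the Lorentz form
    w.w' - (k l' + k' l) / 2.  Half-planes are the unit vectors with k = 0, and
    two tangent disks have product -1 (lemma [tangent_touching]).  For three
    mutually tangent disks A, B, C (written as vectors) the orthogonal
    complement of their span is a line, generated by a unit vector m, which is
    given by 3 x 3 minors (definition [mid]).

    The point of tangency of X and Y is the isotropic vector X + Y.  Hence a
    circle passes through the three points of tangency exactly when its vector
    is orthogonal to A, B and C, i.e. is m or -m: the mid-circle is the circle
    of m.  Gram determinants show that its curvature g satisfies
    g^2 = AB + BC + CA in terms of the curvatures ([curv_mid_sqr]).  This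
    formula also gives the mid-circles that involve D or D', once the curvature
    of D and D' is known.

    A vector of norm 1 with product -1 with each of A, B, C is
    A + B + C + 2 m or A + B + C - 2 m ([descartes_solution]), so D and D' have
    the curvatures A + B + C + 2 g and A + B + C - 2 g in some order.

    On the side of the spinors, |a|^2 = B + C and its analogues, together with
    a + b + c = 0, give a.b = -C and its analogues, hence the areas of the
    yellow and red tiles.  All green tiles have area a x b.  The cross product
    of a^2 and b^2, seen as vectors, is 2 (a.b)(a x b) and is also -2 C g by
    the definition of a spinor; summing the three such relations gives
    a x b = g with the sign included ([spinor_mid]).

    It remains to settle the signs.  If g = 0, the mid-circle is a line and D,
    D' have the same curvature.  Otherwise, as the points of tangency are
    clockwise on the mid-circle, they span a triangle of negative signed area, which is a
    negative multiple of g; so g > 0 ([curv_mid_gt_0]).  With g > 0, the disk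
    A + B + C - 2 m touches one of A, B, C outside the mid-circle, so the
    inscribed disk is A + B + C + 2 m ([inscribed_sign]). *)

(* [nsatz] treats a power as an atom unless it is expanded into a product. *)
Ltac rnsatz := cbn [pow] in *; nsatz.

(** * Oriented circles as vectors of a Lorentz space *)

(** A vector with coordinates the curvature, the two coordinates of the center
    multiplied by the curvature, and the co-curvature.  It stands for the
    quadratic function [eval] below. *)
Record cycle : Type := Cycle { cv : R; cx : R; cy : R; cc : R }.

(** The Lorentz form. *)
Definition lprod (U V : cycle) : R :=
  cx U * cx V + cy U * cy V - (cv U * cc V + cv V * cc U) / 2.

(** The function that is negative in the interior of the disk, zero on its
    boundary and positive outside. *)
Definition eval (U : cycle) (z : C) : R :=
  cv U * (Re z ^ 2 + Im z ^ 2) - 2 * (cx U * Re z + cy U * Im z) + cc U.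

(** Incidence with a point of the extended plane. *)
Definition through (U : cycle) (p : option C) : Prop :=
  match p with
  | Some z => eval U z = 0
  | None => cv U = 0
  end.

Definition add (U V : cycle) : cycle :=
  Cycle (cv U + cv V) (cx U + cx V) (cy U + cy V) (cc U + cc V).

Definition scale (t : R) (U : cycle) : cycle :=
  Cycle (t * cv U) (t * cx U) (t * cy U) (t * cc U).

(** A half-plane is the limit of balls of radius r and center (h - r) n, whose
    vectors converge. *)
Definition cycle_of (X : disk) : cycle :=
  match X with
  | Ball c r => Cycle (/ r) (Re c / r) (Im c / r)
                      ((Re c ^ 2 + Im c ^ 2 - r ^ 2) / r)
  | HalfPlane n h => Cycle 0 (- Re n) (- Im n) (- 2 * h)
  end.

(** The inverse of [cycle_of] on vectors of norm 1. *)
Definition disk_of (U : cycle) : disk :=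
  if Req_EM_T (cv U) 0
  then HalfPlane (- cx U, - cy U) (- cc U / 2)
  else Ball (cx U / cv U, cy U / cv U) (/ cv U).

Lemma cycle_eq (U V : cycle) :
  cv U = cv V -> cx U = cx V -> cy U = cy V -> cc U = cc V -> U = V.
Proof. destruct U, V; simpl; intros; subst; reflexivity. Qed.

Lemma lprod_sym (U V : cycle) : lprod U V = lprod V U.
Proof. unfold lprod; field. Qed.

Lemma lprod_self (U : cycle) : lprod U U = cx U ^ 2 + cy U ^ 2 - cv U * cc U.
Proof. unfold lprod; field. Qed.

Lemma lprod_double (U V : cycle) :
  2 * lprod U V = 2 * (cx U * cx V + cy U * cy V) - (cv U * cc V + cv V * cc U).
Proof. unfold lprod; field. Qed.

Lemma lprod_add (U V W : cycle) : lprod U (add V W) = lprod U V + lprod U W.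
Proof. unfold lprod, add; simpl; field. Qed.

Lemma lprod_scale (t : R) (U V : cycle) : lprod U (scale t V) = t * lprod U V.
Proof. unfold lprod, scale; simpl; field. Qed.

Lemma sum_pow2_eq_0 (x y : R) : x ^ 2 + y ^ 2 = 0 -> x = 0 /\ y = 0.
Proof. rewrite <- !Rsqr_pow2; apply Rplus_sqr_eq_0. Qed.

Lemma Cmod_sqr (z : C) : Cmod z ^ 2 = Re z ^ 2 + Im z ^ 2.
Proof.
unfold Cmod, Re, Im; rewrite pow2_sqrt; [reflexivity|].
apply Rplus_le_le_0_compat; apply pow2_ge_0.
Qed.

Lemma Cmod_eq_sqr (z : C) (d : R) :
  0 <= d -> (Cmod z = d <-> Re z ^ 2 + Im z ^ 2 = d ^ 2).
Proof.
intros Hd; rewrite <- Cmod_sqr; pose proof (Cmod_ge_0 z).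
split; [intros ->; reflexivity|nra].
Qed.

Lemma Cmod_lt_sqr (z : C) (d : R) :
  0 <= d -> (Cmod z < d <-> Re z ^ 2 + Im z ^ 2 < d ^ 2).
Proof. intros Hd; rewrite <- Cmod_sqr; pose proof (Cmod_ge_0 z); split; nra. Qed.

Lemma lt_Cmod_sqr (z : C) (d : R) :
  0 <= d -> (d < Cmod z <-> d ^ 2 < Re z ^ 2 + Im z ^ 2).
Proof. intros Hd; rewrite <- Cmod_sqr; pose proof (Cmod_ge_0 z); split; nra. Qed.

Lemma cycle_of_unit (X : disk) :
  is_disk X -> lprod (cycle_of X) (cycle_of X) = 1.
Proof.
destruct X as [c r|n h]; unfold lprod; simpl; intros H.
- field; exact H.
- apply Cmod_eq_sqr in H; nra.
Qed.

Lemma cv_cycle_of (X : disk) : cv (cycle_of X) = curv X.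
Proof. destruct X; reflexivity. Qed.

Lemma disk_of_cycle_of (X : disk) : is_disk X -> disk_of (cycle_of X) = X.
Proof.
destruct X as [[c1 c2] r|[n1 n2] h]; unfold disk_of, is_disk; simpl; intros H.
- destruct (Req_EM_T (/ r) 0) as [E|_].
  + now apply Rinv_neq_0_compat in E.
  + f_equal; [f_equal|]; field; assumption.
- destruct (Req_EM_T 0 0) as [_|E]; [|now destruct E].
  f_equal; [f_equal|]; field.
Qed.

Lemma cycle_of_disk_of (U : cycle) : lprod U U = 1 -> cycle_of (disk_of U) = U.
Proof.
destruct U as [k x y l]; unfold disk_of, lprod; simpl; intros H.
destruct (Req_EM_T k 0) as [->|E]; apply cycle_eq; simpl; try field; auto.
replace l with ((x * x + y * y - 1) / k); [field|]; auto.
apply Rmult_eq_reg_r with k; [|exact E].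
unfold Rdiv; rewrite Rmult_assoc, Rinv_l; lra.
Qed.

Lemma is_disk_disk_of (U : cycle) : lprod U U = 1 -> is_disk (disk_of U).
Proof.
destruct U as [k x y l]; unfold disk_of, lprod; simpl; intros H.
destruct (Req_EM_T k 0) as [->|E]; simpl.
- apply Cmod_eq_sqr; simpl; nra.
- now apply Rinv_neq_0_compat.
Qed.

Lemma cycle_of_inj (X Y : disk) :
  is_disk X -> is_disk Y -> cycle_of X = cycle_of Y -> X = Y.
Proof.
intros HX HY E.
now rewrite <- (disk_of_cycle_of X HX), <- (disk_of_cycle_of Y HY), E.
Qed.

Lemma eval_ball (c z : C) (r : R) :
  r <> 0 ->
  Re (z - c)%C ^ 2 + Im (z - c)%C ^ 2 - r ^ 2 = r * eval (cycle_of (Ball c r)) z.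
Proof.
intros H; unfold eval; simpl cycle_of; cbn [cv cx cy cc].
replace (Re (z - c)%C) with (Re z - Re c) by (unfold Re; simpl; ring).
replace (Im (z - c)%C) with (Im z - Im c) by (unfold Im; simpl; ring).
field; exact H.
Qed.

Lemma on_boundary (X : disk) (p : option C) :
  is_disk X -> (on_circle (boundary X) p <-> through (cycle_of X) p).
Proof.
destruct X as [c r|n h], p as [z|]; simpl on_circle; intros H; simpl in H.
- rewrite Cmod_eq_sqr, pow2_abs by apply Rabs_pos.
  unfold through; pose proof (eval_ball c z r H) as E; split; intros E'; [|nra].
  apply Rmult_eq_reg_l with r; [lra|exact H].
- simpl; split; [tauto|now apply Rinv_neq_0_compat].
- unfold through, eval, dot; simpl; lra.
- simpl; tauto.
Qed.

Lemma in_interior_eval (X : disk) (z : C) :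
  is_disk X -> (in_interior X z <-> eval (cycle_of X) z < 0).
Proof.
destruct X as [c r|n h]; simpl in_interior; intros H; simpl in H.
- pose proof (eval_ball c z r H) as E; set (e := eval _ z) in *; clearbody e.
  destruct (Rdichotomy r 0 H) as [Hr|Hr].
  + rewrite lt_Cmod_sqr by lra. split; [intros [[]|[]]; nra|right; nra].
  + rewrite Cmod_lt_sqr by lra. split; [intros [[]|[]]; nra|left; nra].
- unfold eval, dot; simpl; lra.
Qed.

(** All four cases of [spinor_square] are a single formula in coordinates. *)
Lemma spinor_square_cycle (X Y : disk) (x := cycle_of X) (y := cycle_of Y) :
  is_disk X -> is_disk Y ->
  spinor_square X Y = (cv x * cx y - cv y * cx x, cv x * cy y - cv y * cy x).
Proof.
unfold x, y; clear x y.
destruct X as [[c1 c2] r|[n1 n2] h], Y as [[d1 d2] s|[m1 m2] l];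
  simpl; intros HX HY;
  unfold Cdiv, Cminus, Cplus, Cmult, Cinv, Copp, RtoC; simpl;
  f_equal; try field; auto.
Qed.

(** * Tangency *)

(** Two quadratic functions k t^2 s - t s and k' t^2 s - t s of t are negative
    for a common small t > 0. *)
Lemma small_step (k k' s : R) :
  0 < s -> exists t, 0 < t /\ t * s * (k * t - 1) < 0 /\ t * s * (k' * t - 1) < 0.
Proof.
intros Hs; set (m := 1 + Rabs k + Rabs k').
assert (Hm : 0 < m /\ k < m /\ k' < m).
{ unfold m; pose proof (Rle_abs k); pose proof (Rle_abs k').
  pose proof (Rabs_pos k); pose proof (Rabs_pos k'); lra. }
exists (/ m); assert (Hi : 0 < / m) by (apply Rinv_0_lt_compat; lra).
assert (/ m * m = 1) by (field; lra).
assert (Hp : 0 < / m * s) by (apply Rmult_lt_0_compat; lra).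
assert (k * / m < 1 /\ k' * / m < 1) by (split; nra).
split; [lra|split]; set (i := / m) in *; clearbody i; nra.
Qed.

(** In coordinates centered at a common boundary point, the two functions
    [eval] are k |h|^2 + 2 n.h and k' |h|^2 + 2 m.h, with n and m the unit
    outward normals.  Unless m = -n, a small step along -(n + m) enters both
    interiors; and then, unless k + k' > 0, there is a second common boundary
    point or a common interior point. *)
Lemma tangency_finite (U V : cycle) (z : C) :
  lprod U U = 1 -> lprod V V = 1 -> eval U z = 0 -> eval V z = 0 ->
  (forall w, ~ (eval U w < 0 /\ eval V w < 0)) ->
  (forall w, eval U w = 0 -> eval V w = 0 -> w = z) ->
  lprod U V = -1 /\ 0 < cv U + cv V.
Proof.
intros HU HV EU EV Hdisj Huniq; destruct z as [p q].
set (n1 := cv U * p - cx U); set (n2 := cv U * q - cy U).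
set (m1 := cv V * p - cx V); set (m2 := cv V * q - cy V).
assert (FU : forall x y, eval U (p + x, q + y) =
  cv U * (x ^ 2 + y ^ 2) + 2 * (n1 * x + n2 * y)).
{ intros x y; unfold eval in *; simpl in *; unfold n1, n2; lra. }
assert (FV : forall x y, eval V (p + x, q + y) =
  cv V * (x ^ 2 + y ^ 2) + 2 * (m1 * x + m2 * y)).
{ intros x y; unfold eval in *; simpl in *; unfold m1, m2; lra. }
assert (Hn : n1 ^ 2 + n2 ^ 2 = 1).
{ rewrite lprod_self in HU; unfold n1, n2, eval in *; simpl in *; clear - HU EU; rnsatz. }
assert (Hm : m1 ^ 2 + m2 ^ 2 = 1).
{ rewrite lprod_self in HV; unfold m1, m2, eval in *; simpl in *; clear - HV EV; rnsatz. }
assert (Hg : lprod U V = n1 * m1 + n2 * m2).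
{ transitivity (n1 * m1 + n2 * m2 - (cv U * eval V (p, q) + cv V * eval U (p, q)) / 2).
  - unfold lprod, eval, n1, n2, m1, m2; simpl; field.
  - rewrite EU, EV; field. }
set (g := n1 * m1 + n2 * m2) in *.
assert (Hg1 : g = -1).
{ destruct (Rle_or_lt (1 + g) 0) as [H|H].
  - pose proof (pow2_ge_0 (n1 + m1)); pose proof (pow2_ge_0 (n2 + m2)).
    unfold g in *; lra.
  - exfalso; destruct (small_step (cv U) (cv V) (2 + 2 * g)) as (t & Ht & H1 & H2).
    { lra. }
    (* A step along the opposite of the sum of the outward normals. *)
    apply (Hdisj (p + - t * (n1 + m1), q + - t * (n2 + m2))).
    rewrite FU, FV; split.
    + match goal with |- ?l < 0 => replace l with (t * (2 + 2 * g) * (cv U * t - 1)) end.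
      * exact H1.
      * clear - Hn Hm; unfold g; rnsatz.
    + match goal with |- ?l < 0 => replace l with (t * (2 + 2 * g) * (cv V * t - 1)) end.
      * exact H2.
      * clear - Hn Hm; unfold g; rnsatz. }
split; [lra|].
assert (E0 : (m1 + n1) ^ 2 + (m2 + n2) ^ 2 = 0) by (unfold g in *; lra).
destruct (sum_pow2_eq_0 _ _ E0).
assert (E1 : m1 = - n1) by lra.
assert (E2 : m2 = - n2) by lra.
rewrite E1, E2 in FV; clear - Hn FU FV Hdisj Huniq.
assert (Q : 0 < ((cv V - cv U) / 4) ^ 2 + 1)
  by (pose proof (pow2_ge_0 ((cv V - cv U) / 4)); lra).
(* The point at (x, y) is the inverse of a point (e n + n') with n' a unit
   vector orthogonal to n; e is chosen so that both functions take the same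
   value there, (k + k') / 2 times |(x, y)|^2. *)
set (e := (cv V - cv U) / 4) in *.
set (x := (e * n1 - n2) / (e ^ 2 + 1)); set (y := (e * n2 + n1) / (e ^ 2 + 1)).
assert (N : x ^ 2 + y ^ 2 = / (e ^ 2 + 1)).
{ transitivity ((n1 ^ 2 + n2 ^ 2) / (e ^ 2 + 1)).
  - unfold x, y; field; lra.
  - rewrite Hn; field; lra. }
assert (S : n1 * x + n2 * y = e / (e ^ 2 + 1)).
{ transitivity (e * (n1 ^ 2 + n2 ^ 2) / (e ^ 2 + 1)).
  - unfold x, y; field; lra.
  - rewrite Hn; field; lra. }
assert (GU : eval U (p + x, q + y) = (cv U + cv V) / 2 * / (e ^ 2 + 1)).
{ rewrite FU, N, S; unfold Rdiv at 1.
  replace (cv V) with (cv U + 4 * e) by (unfold e; field). field; lra. }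
assert (GV : eval V (p + x, q + y) = (cv U + cv V) / 2 * / (e ^ 2 + 1)).
{ rewrite FV, N. replace (- n1 * x + - n2 * y) with (- (n1 * x + n2 * y)) by ring.
  rewrite S. replace (cv V) with (cv U + 4 * e) by (unfold e; field). field; lra. }
assert (I : 0 < / (e ^ 2 + 1)) by (apply Rinv_0_lt_compat; lra).
destruct (Rtotal_order (cv U + cv V) 0) as [H|[H|H]]; [exfalso|exfalso|exact H].
- apply (Hdisj (p + x, q + y)); rewrite GU, GV; split; nra.
- rewrite H in GU, GV.
  assert (E : (p + x, q + y) = (p, q)) by (apply Huniq; lra).
  injection E as Ex Ey.
  assert (x = 0) by lra; assert (y = 0) by lra.
  rewrite H0, H1 in N; lra.
Qed.

(** External tangency of two vectors: either at the finite point
    (w + w') / (k + k'), or at infinity, for two opposite half-planes.  In the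
    second case the sum of the vectors is isotropic and nonzero. *)
Definition touching (U V : cycle) : Prop :=
  lprod U V = -1 /\
  (0 < cv U + cv V \/
   (cv U = 0 /\ cv V = 0 /\ cx U + cx V = 0 /\ cy U + cy V = 0 /\
    cc U + cc V <> 0)).

Lemma tangent_touching (X Y : disk) :
  is_disk X -> is_disk Y -> tangent X Y ->
  touching (cycle_of X) (cycle_of Y).
Proof.
intros HX HY [Hdisj [p [[p1 p2] Huniq]]].
assert (HU := cycle_of_unit X HX); assert (HV := cycle_of_unit Y HY).
rewrite on_boundary in p1, p2 by assumption.
assert (D : forall w, ~ (eval (cycle_of X) w < 0 /\ eval (cycle_of Y) w < 0)).
{ intros w; rewrite <- !in_interior_eval by assumption; apply Hdisj. }
assert (Un : forall w, eval (cycle_of X) w = 0 -> eval (cycle_of Y) w = 0 ->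
  p = Some w).
{ intros w E1 E2; apply Huniq; split; rewrite on_boundary by assumption;
  assumption. }
clear Hdisj Huniq; set (U := cycle_of X) in *; set (V := cycle_of Y) in *.
clearbody U V; destruct p as [z|]; simpl in p1, p2.
- destruct (tangency_finite U V z) as [E K]; auto.
  + intros w E1 E2; specialize (Un w E1 E2); congruence.
  + split; auto.
- destruct U as [k x y l], V as [k' x' y' l'].
  unfold touching, lprod, eval in *; simpl in *; subst k k'.
  assert (NU : x * x + y * y = 1) by lra.
  assert (NV : x' * x' + y' * y' = 1) by lra.
  assert (E : x * x' + y * y' = -1).
  { destruct (Rle_or_lt (1 + (x * x' + y * y')) 0) as [H|H].
    - pose proof (pow2_ge_0 (x + x')); pose proof (pow2_ge_0 (y + y')); nra.
    - (* Two half-planes whose normals are not opposite overlap far away along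
         the opposite of the sum of the normals. *)
      exfalso; set (g := 1 + (x * x' + y * y')) in *.
      set (t := (1 + Rabs l + Rabs l') / g).
      assert (T : t * g = 1 + Rabs l + Rabs l') by (unfold t; field; lra).
      pose proof (Rle_abs l); pose proof (Rle_abs l').
      pose proof (Rabs_pos l); pose proof (Rabs_pos l').
      apply (D (t * (x + x'), t * (y + y'))); simpl.
      assert (x * (t * (x + x')) + y * (t * (y + y')) = t * g)
        by (unfold g; clear - NU; rnsatz).
      assert (x' * (t * (x + x')) + y' * (t * (y + y')) = t * g)
        by (unfold g; clear - NV; rnsatz).
      lra. }
  destruct (sum_pow2_eq_0 (x + x') (y + y')) as [E1 E2]; [lra|].
  split; [lra|right; repeat split; auto].
  (* Otherwise the two half-planes have the same boundary line, and its foot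
     from the origin is a second common point. *)
  intros L. enough (None = Some (l / 2 * x, l / 2 * y)) by discriminate.
  replace x' with (- x) in * by lra; replace y' with (- y) in * by lra.
  assert (x * (l / 2 * x) + y * (l / 2 * y) = l / 2) by (clear - NU; rnsatz).
  apply Un; simpl; lra.
Qed.

Lemma touching_curv_ge_0 (U V : cycle) : touching U V -> 0 <= cv U + cv V.
Proof. intros [_ [H|(-> & -> & _)]]; lra. Qed.

Lemma tangency_point_coords (U V : cycle) (z : C) :
  lprod U U = 1 -> lprod V V = 1 -> lprod U V = -1 ->
  eval U z = 0 -> eval V z = 0 ->
  (cv U + cv V) * Re z = cx U + cx V /\ (cv U + cv V) * Im z = cy U + cy V.
Proof.
intros HU HV H EU EV.
assert (E : ((cv U + cv V) * Re z - (cx U + cx V)) ^ 2 +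
            ((cv U + cv V) * Im z - (cy U + cy V)) ^ 2 = 0).
{ pose proof (lprod_double U V) as H2; rewrite H in H2.
  rewrite lprod_self in HU, HV; unfold eval in *; clear H; rnsatz. }
destruct (sum_pow2_eq_0 _ _ E); split; lra.
Qed.

(** The vector U + V represents the point of tangency, up to a scalar. *)
Lemma eval_tangency_point (U V W : cycle) (z : C) :
  lprod U U = 1 -> lprod V V = 1 -> touching U V ->
  eval U z = 0 -> eval V z = 0 ->
  0 < cv U + cv V /\ (cv U + cv V) * eval W z = - 2 * lprod W (add U V).
Proof.
intros HU HV [H H'] EU EV.
destruct (tangency_point_coords U V z) as [E1 E2]; auto.
assert (K : 0 < cv U + cv V).
{ destruct H' as [K|(K1 & K2 & K3 & K4 & K5)]; [exact K|exfalso].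
  unfold eval, lprod in *. rewrite K1, K2 in *. apply K5.
  replace (cx V) with (- cx U) in * by lra.
  replace (cy V) with (- cy U) in * by lra. lra. }
split; [exact K|].
apply Rmult_eq_reg_l with (cv U + cv V); [|lra].
pose proof (lprod_double W (add U V)) as HW.
pose proof (lprod_double U V) as H2; rewrite H in H2.
rewrite lprod_self in HU, HV; unfold eval, add in *; simpl in *.
set (w := lprod _ _) in *; clearbody w; clear H H' K; rnsatz.
Qed.

Lemma through_tangency_point (U V W : cycle) (p : option C) :
  lprod U U = 1 -> lprod V V = 1 -> touching U V ->
  through U p -> through V p ->
  (through W p <-> lprod W (add U V) = 0).
Proof.
intros HU HV HT pU pV; destruct p as [z|]; simpl in *.
- destruct (eval_tangency_point U V W z) as [K E]; auto.
  split; intros E'; [rewrite E' in E; lra|].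
  apply Rmult_eq_reg_l with (cv U + cv V); lra.
- destruct HT as [_ [K|(_ & _ & E1 & E2 & E3)]]; [lra|].
  unfold lprod, add; simpl; rewrite pU, pV, E1, E2.
  split; [intros ->; field|intros E].
  apply Rmult_eq_reg_r with (cc U + cc V); lra.
Qed.

(** * The mid-circle of three mutually tangent disks *)

(** The determinant of a 3 x 3 matrix given by its rows. *)
Definition det3 (u1 u2 u3 v1 v2 v3 w1 w2 w3 : R) : R :=
  u1 * (v2 * w3 - v3 * w2) - u2 * (v1 * w3 - v3 * w1) + u3 * (v1 * w2 - v2 * w1).

(** The generalized cross product of three vectors, halved so as to have norm 1
    when the three circles are mutually tangent.  The sign is such that the
    curvature is positive for a clockwise triple whose mid-circle is not a
    line. *)
Definition mid (U V W : cycle) : cycle :=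
  Cycle
    (- det3 (cx U) (cy U) (cv U) (cx V) (cy V) (cv V) (cx W) (cy W) (cv W) / 2)
    (- det3 (cy U) (cv U) (cc U) (cy V) (cv V) (cc V) (cy W) (cv W) (cc W) / 4)
    (det3 (cx U) (cv U) (cc U) (cx V) (cv V) (cc V) (cx W) (cv W) (cc W) / 4)
    (det3 (cx U) (cy U) (cc U) (cx V) (cy V) (cc V) (cx W) (cy W) (cc W) / 2).

(** Three mutually tangent disks, as vectors. *)
Definition triple (U V W : cycle) : Prop :=
  (lprod U U = 1 /\ lprod V V = 1 /\ lprod W W = 1) /\
  (touching U V /\ touching V W /\ touching W U).

Lemma mid_orth (U V W : cycle) :
  lprod (mid U V W) U = 0 /\ lprod (mid U V W) V = 0 /\ lprod (mid U V W) W = 0.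
Proof. unfold lprod, mid, det3; simpl; repeat split; field. Qed.

Lemma mid_gram (U V W : cycle) :
  lprod (mid U V W) (mid U V W) =
  - det3 (lprod U U) (lprod U V) (lprod W U)
         (lprod U V) (lprod V V) (lprod V W)
         (lprod W U) (lprod V W) (lprod W W) / 4.
Proof. unfold lprod, mid, det3; simpl; field. Qed.

Lemma mid_unit (U V W : cycle) :
  triple U V W -> lprod (mid U V W) (mid U V W) = 1.
Proof.
intros [(HU & HV & HW) ((H1 & _) & (H2 & _) & (H3 & _))].
rewrite mid_gram, HU, HV, HW, H1, H2, H3; unfold det3; field.
Qed.

(** The curvature is the product with an isotropic vector, up to a scalar; the
    right-hand side is a Gram determinant bordered by the three curvatures. *)
Lemma curv_mid_gram (U V W : cycle) :
  4 * cv (mid U V W) ^ 2 =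
    cv U ^ 2 * (lprod V V * lprod W W - lprod V W ^ 2)
  + cv V ^ 2 * (lprod W W * lprod U U - lprod W U ^ 2)
  + cv W ^ 2 * (lprod U U * lprod V V - lprod U V ^ 2)
  + 2 * (cv U * cv V) * (lprod V W * lprod W U - lprod U V * lprod W W)
  + 2 * (cv V * cv W) * (lprod W U * lprod U V - lprod V W * lprod U U)
  + 2 * (cv W * cv U) * (lprod U V * lprod V W - lprod W U * lprod V V).
Proof. unfold lprod, mid, det3; simpl; field. Qed.

Lemma curv_mid_sqr (U V W : cycle) :
  triple U V W ->
  cv (mid U V W) ^ 2 = cv U * cv V + cv V * cv W + cv W * cv U.
Proof.
intros [(HU & HV & HW) ((H1 & _) & (H2 & _) & (H3 & _))].
pose proof (curv_mid_gram U V W) as E.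
rewrite HU, HV, HW, H1, H2, H3 in E; lra.
Qed.

(** Cramer's rule: the coordinates of a vector in the kernel of a 3 x 4 matrix
    are proportional to the signed minors. *)
Lemma det3_kernel (u1 u2 u3 u4 v1 v2 v3 v4 w1 w2 w3 w4 y1 y2 y3 y4 : R) :
  u1 * y1 + u2 * y2 + u3 * y3 + u4 * y4 = 0 ->
  v1 * y1 + v2 * y2 + v3 * y3 + v4 * y4 = 0 ->
  w1 * y1 + w2 * y2 + w3 * y3 + w4 * y4 = 0 ->
  y1 * det3 u1 u3 u4 v1 v3 v4 w1 w3 w4 + y2 * det3 u2 u3 u4 v2 v3 v4 w2 w3 w4 = 0.
Proof.
intros E1 E2 E3.
transitivity (
    (u1 * y1 + u2 * y2 + u3 * y3 + u4 * y4) * (v3 * w4 - v4 * w3)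
  - (v1 * y1 + v2 * y2 + v3 * y3 + v4 * y4) * (u3 * w4 - u4 * w3)
  + (w1 * y1 + w2 * y2 + w3 * y3 + w4 * y4) * (u3 * v4 - u4 * v3)).
- unfold det3; ring.
- rewrite E1, E2, E3; ring.
Qed.

(** The orthogonal complement of a triple is the line spanned by [mid]. *)
Lemma orth_mid (U V W Z : cycle) :
  triple U V W -> lprod Z U = 0 -> lprod Z V = 0 -> lprod Z W = 0 ->
  Z = scale (lprod Z (mid U V W)) (mid U V W).
Proof.
intros T EU EV EW; pose proof (mid_unit U V W T) as HM.
(* Z is proportional to [mid U V W], one pair of coordinates at a time.  The
   Lorentz form pairs cv with -cc / 2. *)
assert (Pxk : cx Z * cv (mid U V W) = cv Z * cx (mid U V W)).
{ pose proof (det3_kernel (cx U) (cc U) (cy U) (cv U) (cx V) (cc V) (cy V) (cv V)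
    (cx W) (cc W) (cy W) (cv W) (cx Z) (- cv Z / 2) (cy Z) (- cc Z / 2)) as E.
  unfold lprod, mid, det3 in *; simpl; lra. }
assert (Pyk : cy Z * cv (mid U V W) = cv Z * cy (mid U V W)).
{ pose proof (det3_kernel (cy U) (cc U) (cx U) (cv U) (cy V) (cc V) (cx V) (cv V)
    (cy W) (cc W) (cx W) (cv W) (cy Z) (- cv Z / 2) (cx Z) (- cc Z / 2)) as E.
  unfold lprod, mid, det3 in *; simpl; lra. }
assert (Pck : cc Z * cv (mid U V W) = cv Z * cc (mid U V W)).
{ pose proof (det3_kernel (cv U) (cc U) (cx U) (cy U) (cv V) (cc V) (cx V) (cy V)
    (cv W) (cc W) (cx W) (cy W) (- cc Z / 2) (- cv Z / 2) (cx Z) (cy Z)) as E.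
  unfold lprod, mid, det3 in *; simpl; lra. }
assert (Pxy : cx Z * cy (mid U V W) = cy Z * cx (mid U V W)).
{ pose proof (det3_kernel (cx U) (cy U) (cv U) (cc U) (cx V) (cy V) (cv V) (cc V)
    (cx W) (cy W) (cv W) (cc W) (cx Z) (cy Z) (- cc Z / 2) (- cv Z / 2)) as E.
  unfold lprod, mid, det3 in *; simpl; lra. }
assert (Pxc : cx Z * cc (mid U V W) = cc Z * cx (mid U V W)).
{ pose proof (det3_kernel (cx U) (cv U) (cy U) (cc U) (cx V) (cv V) (cy V) (cc V)
    (cx W) (cv W) (cy W) (cc W) (cx Z) (- cc Z / 2) (cy Z) (- cv Z / 2)) as E.
  unfold lprod, mid, det3 in *; simpl; lra. }
assert (Pyc : cy Z * cc (mid U V W) = cc Z * cy (mid U V W)).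
{ pose proof (det3_kernel (cy U) (cv U) (cx U) (cc U) (cy V) (cv V) (cx V) (cc V)
    (cy W) (cv W) (cx W) (cc W) (cy Z) (- cc Z / 2) (cx Z) (- cv Z / 2)) as E.
  unfold lprod, mid, det3 in *; simpl; lra. }
set (M := mid U V W) in *; clearbody M; clear T EU EV EW.
rewrite lprod_self in HM; pose proof (lprod_double Z M) as Ht.
set (t := lprod Z M) in *; clearbody t.
destruct M as [k x y l], Z as [k' x' y' l'].
unfold scale; simpl in *; apply cycle_eq; simpl; rnsatz.
Qed.

Lemma boundary_of_circle (M : gcircle) :
  is_circle M -> exists X, is_disk X /\ M = boundary X /\ circle_curv M = Rabs (curv X).
Proof.
destruct M as [o rho|n h]; simpl; intros H.
- exists (Ball o rho); simpl; repeat split; [lra| |].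
  + now rewrite Rabs_right by lra.
  + rewrite Rabs_right; [reflexivity|].
    now apply Rle_ge, Rlt_le, Rinv_0_lt_compat.
- exists (HalfPlane n h); simpl; now rewrite Rabs_R0.
Qed.

Lemma is_circle_boundary (X : disk) : is_disk X -> is_circle (boundary X).
Proof. destruct X; simpl; [apply Rabs_pos_lt|auto]. Qed.

(** Three mutually tangent disks. *)
Definition disk_triple (X Y Z : disk) : Prop :=
  (is_disk X /\ is_disk Y /\ is_disk Z) /\
  (tangent X Y /\ tangent Y Z /\ tangent Z X).

Lemma disk_triple_cycles (X Y Z : disk) :
  disk_triple X Y Z -> triple (cycle_of X) (cycle_of Y) (cycle_of Z).
Proof.
intros [(HX & HY & HZ) (H1 & H2 & H3)].
repeat split; try (now apply cycle_of_unit);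
  now apply tangent_touching.
Qed.

(** A disk bounded by the mid-circle. *)
Definition mid_disk (X Y Z : disk) : disk :=
  disk_of (mid (cycle_of X) (cycle_of Y) (cycle_of Z)).

Lemma on_circle_tangency_point (X Y W : disk) (p : option C) :
  is_disk X -> is_disk Y -> tangent X Y -> is_disk W -> tangency_point X Y p ->
  (on_circle (boundary W) p <->
   lprod (cycle_of W) (add (cycle_of X) (cycle_of Y)) = 0).
Proof.
intros HX HY HT HW [H1 H2].
rewrite on_boundary in * by assumption.
apply through_tangency_point; auto using cycle_of_unit, tangent_touching.
Qed.

Lemma mid_disk_midcircle (X Y Z : disk) :
  disk_triple X Y Z -> is_midcircle (boundary (mid_disk X Y Z)) X Y Z.
Proof.
intros T; pose proof (mid_unit _ _ _ (disk_triple_cycles _ _ _ T)) as HM.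
destruct T as [(HX & HY & HZ) (H1 & H2 & H3)].
pose proof (is_disk_disk_of _ HM) as HD; fold (mid_disk X Y Z) in HD.
pose proof (cycle_of_disk_of _ HM) as EM; fold (mid_disk X Y Z) in EM.
destruct (mid_orth (cycle_of X) (cycle_of Y) (cycle_of Z)) as (O1 & O2 & O3).
rewrite <- EM in O1, O2, O3.
split; [now apply is_circle_boundary|].
destruct H1 as [D1 [s [Hs Us]]], H2 as [D2 [p [Hp Up]]], H3 as [D3 [q [Hq Uq]]].
exists p, q, s; do 3 (split; [assumption|]).
rewrite (on_circle_tangency_point Y Z), (on_circle_tangency_point Z X),
  (on_circle_tangency_point X Y); rewrite ?lprod_add; auto;
  try (repeat split; try lra; fail); split; auto; eexists; split; eauto.
Qed.

(** A mid-circle is orthogonal to the three disks, so its vector is [mid] or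
    its opposite. *)
Lemma midcircle_curvature_intro (X Y Z : disk) (k : R) :
  disk_triple X Y Z ->
  k ^ 2 = curv X * curv Y + curv Y * curv Z + curv Z * curv X ->
  midcircle_curvature X Y Z k.
Proof.
intros T Hk; split; [exists (boundary (mid_disk X Y Z)); now apply mid_disk_midcircle|].
intros M [HM (p & q & s & Hp & Hq & Hs & Mp & Mq & Ms)].
pose proof (disk_triple_cycles _ _ _ T) as T'.
destruct T as [(HX & HY & HZ) (H1 & H2 & H3)].
destruct (boundary_of_circle M HM) as (W & HW & -> & ->).
rewrite (on_circle_tangency_point Y Z) in Mp by assumption.
rewrite (on_circle_tangency_point Z X) in Mq by assumption.
rewrite (on_circle_tangency_point X Y) in Ms by assumption.
rewrite lprod_add in Mp, Mq, Ms.
pose proof (cycle_of_unit W HW) as NW.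
pose proof (curv_mid_sqr _ _ _ T') as EM; pose proof (mid_unit _ _ _ T') as NM.
pose proof (orth_mid _ _ _ (cycle_of W) T' ltac:(lra) ltac:(lra) ltac:(lra)) as E.
rewrite !cv_cycle_of in EM; rewrite <- Hk in EM.
set (N := mid _ _ _) in *; set (t := lprod (cycle_of W) N) in *; clearbody t.
(* Both vectors have norm 1. *)
assert (Et : t ^ 2 = 1).
{ rewrite E, lprod_scale, (lprod_sym (scale t N)), lprod_scale, NM in NW; lra. }
rewrite <- (cv_cycle_of W), E; unfold scale; cbn [cv].
apply Rsqr_eq_abs_0; unfold Rsqr.
transitivity (t ^ 2 * cv N ^ 2); [rewrite Et, EM|]; ring.
Qed.

(** * The two solutions of the Descartes problem *)

(** The difference with U + V + W is orthogonal to the triple and has norm 4. *)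
Lemma descartes_solution (U V W Z : cycle) :
  triple U V W -> lprod Z Z = 1 ->
  lprod Z U = -1 -> lprod Z V = -1 -> lprod Z W = -1 ->
  exists t, (t = 1 \/ t = -1) /\
    Z = add (add (add U V) W) (scale (2 * t) (mid U V W)).
Proof.
intros T HZ EU EV EW; pose proof (mid_unit _ _ _ T) as NM.
pose proof (orth_mid U V W (add Z (scale (-1) (add (add U V) W))) T) as E.
destruct T as [(HU & HV & HW) ((H1 & _) & (H2 & _) & (H3 & _))].
set (S := add (add U V) W) in *; set (M := mid U V W) in *.
assert (SU : lprod U S = -1).
{ unfold S; rewrite !lprod_add, (lprod_sym U W); lra. }
assert (SV : lprod V S = -1).
{ unfold S; rewrite !lprod_add, (lprod_sym V U); lra. }
assert (SW : lprod W S = -1).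
{ unfold S; rewrite !lprod_add, (lprod_sym W V); lra. }
assert (SZ : lprod Z S = -3) by (unfold S; rewrite !lprod_add; lra).
assert (SS : lprod S S = -3).
{ unfold S at 2; rewrite !lprod_add, !(lprod_sym S); lra. }
set (D := add Z (scale (-1) S)) in *.
assert (DD : lprod D D = 4).
{ unfold D at 2; rewrite lprod_add, lprod_scale, !(lprod_sym D).
  unfold D; rewrite !lprod_add, !lprod_scale, (lprod_sym S Z); lra. }
specialize (E ltac:(rewrite lprod_sym; unfold D; rewrite lprod_add, lprod_scale, (lprod_sym U Z); lra)
  ltac:(rewrite lprod_sym; unfold D; rewrite lprod_add, lprod_scale, (lprod_sym V Z); lra)
  ltac:(rewrite lprod_sym; unfold D; rewrite lprod_add, lprod_scale, (lprod_sym W Z); lra)).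
set (t := lprod D M) in *; clearbody t.
assert (Et : t * t = 4).
{ rewrite E, lprod_scale, (lprod_sym (scale t M)), lprod_scale, NM in DD; lra. }
exists (t / 2); split.
- assert (F : (t - 2) * (t + 2) = 0) by lra.
  apply Rmult_integral in F; destruct F; [left|right]; lra.
- assert (Ek := f_equal cv E); assert (Ex := f_equal cx E);
  assert (Ey := f_equal cy E); assert (Ec := f_equal cc E).
  unfold D in *; simpl in Ek, Ex, Ey, Ec.
  apply cycle_eq; simpl in *; lra.
Qed.

(** * Orientation and the inscribed disk *)

(** The left-hand side is -4 sin x sin y sin (x + y) with x, y the half-angles;
    it is twice the signed area of a triangle inscribed in the unit circle. *)
Lemma sin_cyclic (alpha beta gamma : R) :
  alpha > beta -> beta > gamma -> gamma > alpha - 2 * PI ->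
  sin (beta - alpha) + sin (gamma - beta) + sin (alpha - gamma) < 0.
Proof.
intros H1 H2 H3.
set (x := (alpha - beta) / 2); set (y := (beta - gamma) / 2).
replace (beta - alpha) with (- (2 * x)) by (unfold x; field).
replace (gamma - beta) with (- (2 * y)) by (unfold y; field).
replace (alpha - gamma) with (2 * x + 2 * y) by (unfold x, y; field).
assert (Sx : 0 < sin x) by (apply sin_gt_0; unfold x; lra).
assert (Sy : 0 < sin y) by (apply sin_gt_0; unfold y; lra).
assert (Sxy : 0 < sin (x + y)) by (apply sin_gt_0; unfold x, y; lra).
match goal with |- ?l < 0 => replace l with (- (4 * (sin x * sin y * sin (x + y)))) end.
- assert (0 < sin x * sin y * sin (x + y)) by (repeat apply Rmult_lt_0_compat; auto).
  lra.
- rewrite !sin_neg, !sin_plus, !cos_2a_sin, !sin_2a; ring.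
Qed.

Lemma curv_mid_gt_0 (U V W : cycle) (o : C) (rho alpha beta gamma : R) :
  triple U V W -> 0 < rho ->
  alpha > beta -> beta > gamma -> gamma > alpha - 2 * PI ->
  let p := point_at o rho alpha in
  let q := point_at o rho beta in
  let s := point_at o rho gamma in
  eval V p = 0 -> eval W p = 0 -> eval W q = 0 -> eval U q = 0 ->
  eval U s = 0 -> eval V s = 0 ->
  0 < cv (mid U V W).
Proof.
intros [(HU & HV & HW) (T1 & T2 & T3)] Hr H1 H2 H3 p q s Vp Wp Wq Uq Us Vs.
destruct (eval_tangency_point V W V p) as [Kp _]; auto.
destruct (eval_tangency_point W U W q) as [Kq _]; auto.
destruct (eval_tangency_point U V U s) as [Ks _]; auto.
destruct T1 as [G1 _], T2 as [G2 _], T3 as [G3 _].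
destruct (tangency_point_coords V W p) as [P1 P2]; auto.
destruct (tangency_point_coords W U q) as [Q1 Q2]; auto.
destruct (tangency_point_coords U V s) as [S1 S2]; auto.
pose proof (sin_cyclic _ _ _ H1 H2 H3) as HS.
(* Twice the signed area of the triangle of the points of tangency. *)
set (area := det3 (Re p) (Im p) 1 (Re q) (Im q) 1 (Re s) (Im s) 1).
assert (HA : area = rho ^ 2 *
  (sin (beta - alpha) + sin (gamma - beta) + sin (alpha - gamma))).
{ rewrite !sin_minus; unfold area, det3, p, q, s, point_at; simpl; ring. }
assert (E : (cv V + cv W) * (cv W + cv U) * (cv U + cv V) * area
            = - 4 * cv (mid U V W)).
{ transitivity (det3
    ((cv V + cv W) * Re p) ((cv V + cv W) * Im p) (cv V + cv W)
    ((cv W + cv U) * Re q) ((cv W + cv U) * Im q) (cv W + cv U)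
    ((cv U + cv V) * Re s) ((cv U + cv V) * Im s) (cv U + cv V)).
  - unfold area, det3; ring.
  - rewrite P1, P2, Q1, Q2, S1, S2; unfold mid, det3; simpl; field. }
assert (A0 : area < 0).
{ rewrite HA; assert (0 < rho ^ 2) by nra; nra. }
assert (0 < (cv V + cv W) * (cv W + cv U) * (cv U + cv V))
  by (repeat apply Rmult_lt_0_compat; auto).
nra.
Qed.

Lemma triple_curv_sum_gt_0 (U V W : cycle) :
  triple U V W -> 0 < cv U + cv V + cv W.
Proof.
intros [(HU & HV & HW) (T1 & T2 & T3)].
pose proof (touching_curv_ge_0 _ _ T1); pose proof (touching_curv_ge_0 _ _ T2);
pose proof (touching_curv_ge_0 _ _ T3).
destruct T1 as [_ [?|(A1 & A2 & A3 & A4 & _)]]; [lra|].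
destruct T2 as [_ [?|(B1 & B2 & B3 & B4 & _)]]; [lra|].
destruct T3 as [_ [?|(C1 & C2 & C3 & C4 & _)]]; [lra|].
exfalso; unfold lprod in HU; rewrite A1 in HU.
replace (cx U) with 0 in HU by lra; replace (cy U) with 0 in HU by lra; lra.
Qed.

(** When the mid-circle is a line, the curvature is 0. *)
Lemma clockwise_curv_mid_ge_0 (X Y Z : disk) :
  disk_triple X Y Z -> clockwise X Y Z ->
  0 <= cv (mid (cycle_of X) (cycle_of Y) (cycle_of Z)).
Proof.
intros T HC; set (m := cv _).
destruct (Req_dec m 0) as [E|E]; [lra|].
pose proof (mid_disk_midcircle _ _ _ T) as HM.
unfold mid_disk, disk_of in HM; fold m in HM.
destruct (Req_EM_T m 0) as [E'|_]; [contradiction|].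
destruct (HC _ _ HM) as (al & be & ga & H1 & H2 & H3 & [Yp Zp] & [Zq Xq] & [Xs Ys]).
assert (T' := disk_triple_cycles _ _ _ T).
destruct T as [(HX & HY & HZ) _], HM as [HR _].
rewrite on_boundary in * by assumption.
apply Rlt_le; exact (curv_mid_gt_0 _ _ _ _ _ _ _ _ T' HR H1 H2 H3 Yp Zp Zq Xq Xs Ys).
Qed.

(** The product of [mid] with W is read off at the point where W touches one of
    the three disks, since that point is in W, hence inside the mid-circle. *)
Lemma inscribed_sign (X Y Z W : disk) (t : R)
  (M := mid (cycle_of X) (cycle_of Y) (cycle_of Z)) :
  disk_triple X Y Z -> is_disk W -> tangent X W -> tangent Y W -> tangent Z W ->
  inscribed W X Y Z -> cv M > 0 ->
  lprod M (cycle_of W) = 2 * t -> 0 <= t.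
Proof.
intros T HW TX TY TZ HI HM Ht.
assert (T' := disk_triple_cycles _ _ _ T).
pose proof (mid_disk_midcircle _ _ _ T) as HD.
pose proof (mid_unit _ _ _ T') as NM; fold M in NM.
assert (EM := cycle_of_disk_of _ NM).
unfold mid_disk, disk_of in HD, EM; fold M in HD.
destruct (Req_EM_T (cv M) 0) as [E'|_]; [lra|].
specialize (HI _ _ HD); set (o := (_, _)) in HI, EM.
assert (Hr : 0 < / cv M) by (apply Rinv_0_lt_compat; exact HM).
pose proof (triple_curv_sum_gt_0 _ _ _ T') as HS.
destruct (mid_orth (cycle_of X) (cycle_of Y) (cycle_of Z)) as (OX & OY & OZ).
fold M in OX, OY, OZ.
(* It suffices that W touches one of the three disks at a finite point. *)
assert (L : forall V, is_disk V -> tangent V W -> lprod M (cycle_of V) = 0 ->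
  0 < cv (cycle_of V) + cv (cycle_of W) -> 0 <= t).
{ intros V HV TV OV HK.
  destruct (proj2 TV) as [[z|] [[zV zW] _]];
    pose proof zW as zW'; rewrite on_boundary in zV, zW' by assumption;
    simpl in zV, zW'; [|lra].
  specialize (HI z (or_intror zW)).
  destruct (eval_tangency_point (cycle_of V) (cycle_of W) M z) as [_ E];
    auto using cycle_of_unit, tangent_touching.
  rewrite lprod_add, OV, Ht in E.
  assert (F : eval M z <= 0).
  { rewrite Rabs_right in HI by (apply Rle_ge, Rlt_le, Hr).
    pose proof (eval_ball o z (/ cv M) ltac:(lra)) as E1.
    rewrite EM, <- Cmod_sqr in E1.
    pose proof (Cmod_ge_0 (z - o)%C) as H0; nra. }
  nra. }
assert (KX := touching_curv_ge_0 _ _ (tangent_touching X W ltac:(apply T) HW TX)).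
assert (KY := touching_curv_ge_0 _ _ (tangent_touching Y W ltac:(apply T) HW TY)).
assert (KZ := touching_curv_ge_0 _ _ (tangent_touching Z W ltac:(apply T) HW TZ)).
destruct T as [(HX & HY & HZ) _].
destruct KX as [KX|KX]; [now apply (L X)|].
destruct KY as [KY|KY]; [now apply (L Y)|].
destruct (tangent_touching X W HX HW TX) as [_ [?|(E1 & E2 & _)]]; [lra|].
(* If W touched X, Y and Z at infinity, all curvatures would be 0. *)
apply (L Z); auto; lra.
Qed.

(** * Spinors *)

Lemma spinor_norm (u : C) (X Y : disk) :
  is_disk X -> is_disk Y -> tangent X Y -> tangency_spinor u X Y ->
  Re u ^ 2 + Im u ^ 2 = curv X + curv Y.
Proof.
intros HX HY HT; pose proof (tangent_touching _ _ HX HY HT) as T.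
pose proof (touching_curv_ge_0 _ _ T) as K; destruct T as [T _].
pose proof (cycle_of_unit X HX) as NX; pose proof (cycle_of_unit Y HY) as NY.
unfold tangency_spinor; rewrite spinor_square_cycle by assumption.
rewrite <- !cv_cycle_of; set (U := cycle_of X) in *; set (V := cycle_of Y) in *.
clearbody U V; destruct u as [u1 u2]; unfold Cmult; simpl.
intros E; injection E as E1 E2.
assert (F : (u1 ^ 2 + u2 ^ 2) ^ 2 = (cv U + cv V) ^ 2).
{ pose proof (lprod_double U V) as H2; rewrite T in H2.
  rewrite lprod_self in NX, NY; clear T K; rnsatz. }
nra.
Qed.

(** The area of the green tiles is the curvature of [mid], sign included. *)
Lemma spinor_mid (a b c : C) (X Y Z : disk) :
  disk_triple X Y Z ->
  tangency_spinor a Y Z -> tangency_spinor b Z X -> tangency_spinor c X Y ->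
  (a + b + c)%C = 0%C ->
  cross a b = cv (mid (cycle_of X) (cycle_of Y) (cycle_of Z)).
Proof.
intros T Ha Hb Hc H0.
pose proof (triple_curv_sum_gt_0 _ _ _ (disk_triple_cycles _ _ _ T)) as HS.
destruct T as [(HX & HY & HZ) (T1 & T2 & T3)].
pose proof (spinor_norm _ _ _ HY HZ T2 Ha) as Na.
pose proof (spinor_norm _ _ _ HZ HX T3 Hb) as Nb.
pose proof (spinor_norm _ _ _ HX HY T1 Hc) as Nc.
unfold tangency_spinor in *; rewrite spinor_square_cycle in * by assumption.
rewrite <- !cv_cycle_of in *.
set (U := cycle_of X) in *; set (V := cycle_of Y) in *; set (W := cycle_of Z) in *.
destruct a as [a1 a2], b as [b1 b2], c as [c1 c2].
unfold Cmult, Cplus, RtoC in *; simpl in *.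
injection Ha as A1 A2; injection Hb as B1 B2; injection Hc as C1 C2.
injection H0 as S1 S2.
apply Rmult_eq_reg_l with (cv U + cv V + cv W); [|lra].
unfold cross, mid; cbn [cv Re Im fst snd].
set (d := det3 (cx U) (cy U) (cv U) (cx V) (cy V) (cv V) (cx W) (cy W) (cv W)).
(* Expand |c|^2 = |a + b|^2, and likewise for the other two. *)
assert (Dab : a1 * b1 + a2 * b2 = - cv W).
{ replace c1 with (- a1 - b1) in Nc by lra.
  replace c2 with (- a2 - b2) in Nc by lra. lra. }
assert (Dbc : b1 * c1 + b2 * c2 = - cv U).
{ replace a1 with (- b1 - c1) in Na by lra.
  replace a2 with (- b2 - c2) in Na by lra. lra. }
assert (Dca : c1 * a1 + c2 * a2 = - cv V).
{ replace b1 with (- c1 - a1) in Nb by lra.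
  replace b2 with (- c2 - a2) in Nb by lra. lra. }
assert (Xbc : b1 * c2 - c1 * b2 = a1 * b2 - b1 * a2).
{ replace c1 with (- a1 - b1) by lra. replace c2 with (- a2 - b2) by lra. ring. }
assert (Xca : c1 * a2 - a1 * c2 = a1 * b2 - b1 * a2).
{ replace c1 with (- a1 - b1) by lra. replace c2 with (- a2 - b2) by lra. ring. }
(* Each relation computes the cross product of two squared spinors in two
   ways. *)
assert (EW : cv W * d = 2 * (a1 * b1 + a2 * b2) * (a1 * b2 - b1 * a2)).
{ transitivity ((a1 * a1 - a2 * a2) * (b1 * b2 + b2 * b1)
    - (b1 * b1 - b2 * b2) * (a1 * a2 + a2 * a1)); [|ring].
  rewrite A1, A2, B1, B2; unfold d, det3; ring. }
assert (EU : cv U * d = 2 * (b1 * c1 + b2 * c2) * (b1 * c2 - c1 * b2)).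
{ transitivity ((b1 * b1 - b2 * b2) * (c1 * c2 + c2 * c1)
    - (c1 * c1 - c2 * c2) * (b1 * b2 + b2 * b1)); [|ring].
  rewrite B1, B2, C1, C2; unfold d, det3; ring. }
assert (EV : cv V * d = 2 * (c1 * a1 + c2 * a2) * (c1 * a2 - a1 * c2)).
{ transitivity ((c1 * c1 - c2 * c2) * (a1 * a2 + a2 * a1)
    - (a1 * a1 - a2 * a2) * (c1 * c2 + c2 * c1)); [|ring].
  rewrite C1, C2, A1, A2; unfold d, det3; ring. }
rewrite Dab in EW; rewrite Dbc, Xbc in EU; rewrite Dca, Xca in EV.
lra.
Qed.

(** * Areas of the tiles *)

Lemma disk_tangent_sym (X Y : disk) : tangent X Y -> tangent Y X.
Proof.
intros [D [p [[p1 p2] U]]]; split; [intros z [? ?]; now apply (D z)|].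
exists p; split; [now split|intros q [? ?]; apply U; now split].
Qed.

Lemma green_area (a b c : C) (g : tile) :
  (a + b + c)%C = 0%C -> In g (greens a b c) -> Area g = cross a b.
Proof.
destruct a as [a1 a2], b as [b1 b2], c as [c1 c2]; intros H.
unfold Cplus, RtoC in H; simpl in H; injection H as H1 H2.
replace c1 with (- a1 - b1) by lra; replace c2 with (- a2 - b2) by lra.
simpl; intros [<-|[<-|[<-|[<-|[<-|[<-|[]]]]]]];
  unfold Area, cross, star; simpl; ring.
Qed.

Lemma red_area (a b c : C) (x y z : R) :
  (a + b + c)%C = 0%C ->
  Re a ^ 2 + Im a ^ 2 = y + z -> Re b ^ 2 + Im b ^ 2 = z + x ->
  Re c ^ 2 + Im c ^ 2 = x + y ->
  Area (aligned_red a b c) = x.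
Proof.
destruct a as [a1 a2], b as [b1 b2], c as [c1 c2]; intros H.
unfold Cplus, RtoC in H; simpl in H; injection H as H1 H2.
replace a1 with (- b1 - c1) by lra; replace a2 with (- b2 - c2) by lra.
unfold Area, cross, star; simpl; lra.
Qed.

Lemma yellow_area (v : C) : Area (yellow v) = Re v ^ 2 + Im v ^ 2.
Proof. unfold Area, cross, star; simpl; ring. Qed.

Lemma light_red_area (v w x : C) :
  Area (light_red v w x) = Area (aligned_red v w x).
Proof. unfold Area, cross, star; simpl; ring. Qed.

(** The relations among curvatures and green area on which all the claims rest. *)
Lemma spinor_curvatures (a b c : C) (X Y Z W W' : disk) :
  descartes_configuration X Y Z W -> descartes_configuration X Y Z W' ->
  W' <> W -> clockwise X Y Z -> inscribed W X Y Z ->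
  tangency_spinor a Y Z -> tangency_spinor b Z X -> tangency_spinor c X Y ->
  (a + b + c)%C = 0%C ->
  let g := cross a b in
  g ^ 2 = curv X * curv Y + curv Y * curv Z + curv Z * curv X /\
  curv W = curv X + curv Y + curv Z + 2 * g /\
  curv W' = curv X + curv Y + curv Z - 2 * g.
Proof.
intros [(HX & HY & HZ & HW) (XY & YZ & ZX & XW & YW & ZW)]
  [(_ & _ & _ & HW') (_ & _ & _ & XW' & YW' & ZW')] Hne HC HI Ha Hb Hc H0 g.
assert (T : disk_triple X Y Z) by (unfold disk_triple; auto).
assert (T' := disk_triple_cycles _ _ _ T).
assert (Eg := spinor_mid a b c X Y Z T Ha Hb Hc H0); fold g in Eg.
assert (Em := curv_mid_sqr _ _ _ T').
assert (Hg := clockwise_curv_mid_ge_0 _ _ _ T HC).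
rewrite <- Eg in *; rewrite !cv_cycle_of in Em; split; [exact Em|].
assert (S : forall V, is_disk V -> tangent X V -> tangent Y V -> tangent Z V ->
  exists t, (t = 1 \/ t = -1) /\ cycle_of V =
   add (add (add (cycle_of X) (cycle_of Y)) (cycle_of Z))
    (scale (2 * t) (mid (cycle_of X) (cycle_of Y) (cycle_of Z)))).
{ intros V HV XV YV ZV; apply descartes_solution; auto using cycle_of_unit;
  rewrite lprod_sym; now apply tangent_touching. }
destruct (S W HW XW YW ZW) as (t & Ht & Et).
destruct (S W' HW' XW' YW' ZW') as (t' & Ht' & Et').
assert (Hopp : t' = - t).
{ destruct Ht as [-> | ->], Ht' as [-> | ->]; try lra;
  exfalso; apply Hne, cycle_of_inj; auto; congruence. }
assert (K := f_equal cv Et); assert (K' := f_equal cv Et').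
unfold add, scale in K, K'; cbn [cv] in K, K'.
rewrite <- Eg in K, K'; rewrite !cv_cycle_of in K, K'.
destruct Hg as [Hg|Hg].
- assert (t = 1); [|subst; lra].
  enough (0 <= t) by lra.
  apply (inscribed_sign X Y Z W t); auto; [rewrite <- Eg; exact Hg|].
  destruct (mid_orth (cycle_of X) (cycle_of Y) (cycle_of Z)) as (OX & OY & OZ).
  rewrite Et, !lprod_add, lprod_scale, OX, OY, OZ, (mid_unit _ _ _ T'); lra.
- destruct Ht as [-> | ->]; subst t'; lra.
Qed.

Theorem theorem6 :
  forall (a b c : C) (A B C D D' : disk),
  descartes_configuration A B C D ->
  descartes_configuration A B C D' ->
  D' <> D ->
  clockwise A B C ->
  inscribed D A B C ->
  tangency_spinor a B C ->
  tangency_spinor b C A ->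
  tangency_spinor c A B ->
  (a + b + c)%C = 0%C ->
  (* areas of the yellow squares *)
  (Area (yellow c) = curv A + curv B /\
   Area (yellow a) = curv B + curv C /\
   Area (yellow b) = curv C + curv A) /\
  (* (1) *)
  ((curv A = Area (red_A a b c) /\
    curv B = Area (red_B a b c) /\
    curv C = Area (red_C a b c)) /\
   (forall g g' : tile, In g (greens a b c) -> In g' (greens a b c) ->
      curv D = total_area (reds a b c) + Area g + Area g') /\
   (forall v w x, In (v, w, x) [(a, b, c); (b, c, a); (c, a, b)] ->
      curv D = total_area (butterfly v w x) /\
      (forall g g' : tile, In g (greens a b c) -> In g' (greens a b c) ->
         curv D = Area (yellow v) + Area (aligned_red v w x)
                  + Area g + Area g') /\
      curv D = total_area (ring v w x))) /\
  (* (2) *)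
  ((forall g g' : tile, In g (greens a b c) -> In g' (greens a b c) ->
      Area g = Area g') /\
   (forall g : tile, In g (greens a b c) ->
      midcircle_curvature A B C (Area g) /\
      midcircle_curvature A B D (Area (yellow c) + Area g) /\
      midcircle_curvature B C D (Area (yellow a) + Area g) /\
      midcircle_curvature C A D (Area (yellow b) + Area g))) /\
  (* (3) *)
  ((forall g g' : tile, In g (greens a b c) -> In g' (greens a b c) ->
      curv D' = total_area (reds a b c) - (Area g + Area g')) /\
   (forall v w x, In (v, w, x) [(a, b, c); (b, c, a); (c, a, b)] ->
      forall g g' : tile, In g (greens a b c) -> In g' (greens a b c) ->
      curv D' = Area (yellow v) + Area (aligned_red v w x)
                - (Area g + Area g')) /\
   (forall g : tile, In g (greens a b c) ->
      midcircle_curvature A B D' (Area (yellow c) - Area g) /\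
      midcircle_curvature B C D' (Area (yellow a) - Area g) /\
      midcircle_curvature C A D' (Area (yellow b) - Area g))).
Proof.
intros a b c A B C D D' HD HD' Hne HC HI Ha Hb Hc H0.
destruct (spinor_curvatures a b c A B C D D') as (Hg & KD & KD'); auto.
destruct HD as [(HA & HB & HCd & HDd) (AB & BC & CA & AD & BD & CD)].
destruct HD' as [(_ & _ & _ & HDd') (_ & _ & _ & AD' & BD' & CD')].
pose proof (spinor_norm _ _ _ HB HCd BC Ha) as Na.
pose proof (spinor_norm _ _ _ HCd HA CA Hb) as Nb.
pose proof (spinor_norm _ _ _ HA HB AB Hc) as Nc.
assert (H1 : (b + c + a)%C = 0%C) by (rewrite <- H0; ring).
assert (H2 : (c + a + b)%C = 0%C) by (rewrite <- H0; ring).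
assert (RA := red_area a b c (curv A) (curv B) (curv C) H0 Na Nb Nc).
assert (RB := red_area b c a (curv B) (curv C) (curv A) H1 Nb Nc Na).
assert (RC := red_area c a b (curv C) (curv A) (curv B) H2 Nc Na Nb).
assert (G := fun g => green_area a b c g H0).
assert (Ga1 := G (green1 a b c) ltac:(simpl; tauto)).
assert (Ga2 := G (green2 a b c) ltac:(simpl; tauto)).
assert (Gb1 := G (green1 b c a) ltac:(simpl; tauto)).
assert (Gb2 := G (green2 b c a) ltac:(simpl; tauto)).
assert (Gc1 := G (green1 c a b) ltac:(simpl; tauto)).
assert (Gc2 := G (green2 c a b) ltac:(simpl; tauto)).
assert (LA := light_red_area a b c).
assert (LB := light_red_area b c a).
assert (LC := light_red_area c a b).
assert (Ya := yellow_area a); assert (Yb := yellow_area b);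
assert (Yc := yellow_area c).
rewrite Na in Ya; rewrite Nb in Yb; rewrite Nc in Yc.
assert (TR : total_area (reds a b c) = curv A + curv B + curv C).
{ unfold total_area, reds, red_A, red_B, red_C; simpl; lra. }
set (g0 := cross a b) in *; clearbody g0.
split; [lra|split; [|split]].
- split; [unfold red_A, red_B, red_C; lra|split].
  + intros g g' Hi Hi'; rewrite (G g Hi), (G g' Hi'); lra.
  + intros v w x Hv; simpl in Hv.
    destruct Hv as [E|[E|[E|[]]]]; injection E as <- <- <-;
    (split; [unfold total_area, butterfly; simpl; lra|split;
      [intros g g' Hi Hi'; rewrite (G g Hi), (G g' Hi'); lra
      |unfold total_area, ring; simpl; lra]]).
- split; [intros g g' Hi Hi'; now rewrite (G g Hi), (G g' Hi')|].
  intros g Hi; rewrite (G g Hi), Ya, Yb, Yc.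
  split; [|split; [|split]]; apply midcircle_curvature_intro;
  try (rewrite ?KD; nra);
  unfold disk_triple; auto 6 using disk_tangent_sym.
- split; [intros g g' Hi Hi'; rewrite (G g Hi), (G g' Hi'); lra|split].
  + intros v w x Hv g g' Hi Hi'; rewrite (G g Hi), (G g' Hi'); simpl in Hv.
    destruct Hv as [E|[E|[E|[]]]]; injection E as <- <- <-; lra.
  + intros g Hi; rewrite (G g Hi), Ya, Yb, Yc.
    split; [|split]; apply midcircle_curvature_intro; try (rewrite KD'; nra);
    unfold disk_triple; auto 6 using disk_tangent_sym.
Qed.
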